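(* Let $T$ be a tournament that is not a transitive tournament of even order. Then there exists a set $R$ that is both an exact transversal and a minimum transversal of $\mathrm{mc}(T)$ such that $\mathcal M(T)$ is strictly bipartite by $R$. Moreover, $\mathrm{mc}(T)$ has the König property, i.e. $\nu(\mathrm{mc}(T))=\tau(\mathrm{mc}(T))$.
   Context: A tournament $T=(V(T),A(T))$ is a finite vertex set with, for every two distinct vertices $x,y$, exactly one of the arcs $(x,y),(y,x)$ in $A(T)$; its order is $|V(T)|$. $T$ is transitive if $(x,y),(y,z)\in A(T)$ implies $(x,z)\in A(T)$. For $X\subseteq V(T)$, $\overline X=V(T)\setminus X$. A module of $T$ is a set $M\subseteq V(T)$ such that for all $x,y\in M$ and $v\in V(T)\setminus M$, $(v,x)\in A(T)$ if and only if $(v,y)\in A(T)$. The trivial modules are $\varnothing$, the singletons $\{u\}$ ($u\in V(T)$) and $V(T)$. $\mathcal M(T)$ denotes the set of nontrivial modules of $T$. A co-module of $T$ is a set $M\subseteq V(T)$ such that $M$ or $\overline M$ is a nontrivial module of $T$. $\mathrm{mc}(T)$ denotes the set of co-modules of $T$ that are minimal under inclusion among all co-modules of $T$. Two sets $E,F$ overlap if $E\cap F$, $E\setminus F$ and $F\setminus E$ are all nonempty. Let $\mathcal F$ be a finite family of finite sets. $\mathcal F$ is strictly bipartite by a (finite) set $S$ if $S$ overlaps every element of $\mathcal F$. A transversal of $\mathcal F$ is a (finite) set $R$ with $F\cap R\ne\varnothing$ for every $F\in\mathcal F$; it is exact if $|F\cap R|=1$ for every $F\in\mathcal F$, and minimum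 if it has minimum size among transversals of $\mathcal F$. The transversal number $\tau(\mathcal F)$ is the size of a minimum transversal. A matching of $\mathcal F$ is a set of pairwise disjoint elements of $\mathcal F$, and the matching number $\nu(\mathcal F)$ is the maximum size of a matching. *)

(* Defs.v *)
From mathcomp Require Import all_boot.

Set Implicit Arguments.
Unset Strict Implicit.
Unset Printing Implicit Defensive.

Section SetFamilies.
Variable V : finType.
Implicit Types (E F R S : {set V}) (Fam P : {set {set V}}).

Definition overlap E F :=
  [&& E :&: F != set0, E :\: F != set0 & F :\: E != set0].

Definition strictly_bipartite_by Fam S := [forall F in Fam, overlap S F].

(* Transversals are sets in the ground type V, which contains the members of
   the family: intersecting a transversal with V changes none of the F :&: R
   and does not increase its size. *)
Definition transversal Fam R := [forall F in Fam, F :&: R != set0].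

Definition exact_transversal Fam R :=
  transversal Fam R && [forall F in Fam, #|F :&: R| == 1].

Definition minimum_transversal Fam R :=
  transversal Fam R && [forall S, transversal Fam S ==> (#|R| <= #|S|)].

(* If set0 \notin Fam, then setT is a transversal, of size #|V|, so the
   default value does not affect the minimum. *)
Definition transversal_number Fam :=
  \big[minn/#|V|]_(R : {set V} | transversal Fam R) #|R|.

Definition matching Fam P := (P \subset Fam) && trivIset P.

Definition matching_number Fam :=
  \max_(P : {set {set V}} | matching Fam P) #|P|.

End SetFamilies.

Section Tournaments.
Variables (V : finType) (arc : rel V).
Implicit Types M : {set V}.

Definition tournament : Prop :=
  irreflexive arc /\ forall x y, x != y -> arc x y (+) arc y x.

Definition is_module M :=
  [forall x in M, forall y in M, forall v in ~: M, arc v x == arc v y].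

Definition trivial_module M :=
  [|| M == set0, [exists u, M == [set u]] | M == setT].

Definition nontrivial_module M := is_module M && ~~ trivial_module M.

Definition nontrivial_modules : {set {set V}} := [set M | nontrivial_module M].

Definition comodule M := nontrivial_module M || nontrivial_module (~: M).

Definition minimal_comodules : {set {set V}} := [set M | minset comodule M].

End Tournaments.

(* Main.v *)
From mathcomp Require Import all_boot.
(* Defs comes last: all_boot also exports a [transversal], from finset. *)
Require Import Defs.

(* Two distinct minimal co-modules meet only if both are two-element modules,
   and then they are consecutive links {a, b}, {b, c} of a chain along which the
   out-degree drops by one at each step.  So mc(T) consists of pairwise disjoint
   sets and of disjoint paths.  Taking one vertex in each isolated member and
   every other vertex of each path, skipping one of its ends, gives an exact
   transversal R; pairing each vertex taken with its neighbour towards that end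
   gives a matching of size |R|.

   A nontrivial module and its complement both contain a minimal co-module, so
   only the inclusion of a nontrivial module M in R has to be excluded.  By
   exactness it would force M = {v, w} with v a source or a sink of T, so R must
   avoid the second source and the second sink, which can only be ends of
   chains.  Skipping the right end of each chain achieves this unless a single
   chain of even order links both; then T is transitive of even order. *)

Set Implicit Arguments.
Unset Strict Implicit.
Unset Printing Implicit Defensive.

(** * Weak duality between matchings and transversals *)

Section SetFamilies.
Variable V : finType.
Implicit Types (Fam P : {set {set V}}) (R S X : {set V}).

Lemma transversalP Fam R :
  reflect (forall X, X \in Fam -> exists2 x, x \in X & x \in R)
          (transversal Fam R).
Proof.
apply: (iffP 'forall_implyP) => [trR X /trR/set0Pn[x /setIP[]]|trR X /trR[x Xx Rx]].
  by exists x.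
by apply/set0Pn; exists x; apply/setIP.
Qed.

(** Choosing in each member of [P] a point of [R] is injective, because the members are disjoint. *)
Lemma matching_le_transversal Fam P R :
  matching Fam P -> transversal Fam R -> #|P| <= #|R|.
Proof.
case/andP=> /subsetP PFam trivP /transversalP trR.
have PR X : X \in P -> exists x, x \in X :&: R.
  by move=> /PFam/trR[x Xx Rx]; exists x; apply/setIP.
pose f X := [pick x in X :&: R].
have fP X : X \in P -> exists2 x, f X = Some x & x \in X :&: R.
  move=> PX; rewrite /f; case: pickP => [x Hx|no]; first by exists x.
  by have [x] := PR X PX; rewrite no.
have inj_f : {in P &, injective f}.
  move=> X Y PX PY; have [x -> /setIP[Xx _]] := fP X PX.
  have [y -> /setIP[Yy _] [exy]] := fP Y PY.
  apply/eqP; apply: contraTT Yy => neqXY.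
  by rewrite -exy (disjointFr (trivIsetP trivP X Y PX PY neqXY) Xx).
rewrite -(card_in_imset inj_f) -(card_imset R (@Some_inj _)).
apply: subset_leq_card; apply/subsetP => _ /imsetP[X PX ->].
by have [x -> /setIP[_ Rx]] := fP X PX; rewrite imset_f.
Qed.

Lemma matching_transversal_konig Fam P R :
    matching Fam P -> transversal Fam R -> #|R| <= #|P| ->
  minimum_transversal Fam R /\ matching_number Fam = transversal_number Fam.
Proof.
move=> mP tR leRP; split.
  apply/andP; split=> //; apply/forall_inP => S tS.
  exact: leq_trans leRP (matching_le_transversal mP tS).
apply/eqP; rewrite eqn_leq; apply/andP; split.
  apply/bigmax_leqP => Q mQ; rewrite /transversal_number.
  (* The default value [#|V|] of the minimum bounds [#|Q|] too, since [#|Q| <= #|R| <= #|V|]. *)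
  elim/big_rec: _ => [|S m tS leQm].
    exact: leq_trans (matching_le_transversal mQ tR) (max_card _).
  by rewrite leq_min leQm (matching_le_transversal mQ).
apply: leq_trans (leq_bigmax_cond _ mP); apply: leq_trans leRP.
rewrite /transversal_number; have := mem_index_enum R.
elim: index_enum => //= S s IHs; rewrite inE big_cons => /orP[/eqP<-|/IHs leR].
  by rewrite tR geq_minl.
by case: ifP => // _; apply: leq_trans (geq_minr _ _) leR.
Qed.

End SetFamilies.

(** * Modules of a tournament *)

Section Modules.
Variables (V : finType) (arc : rel V).
Hypothesis tournT : tournament arc.
Implicit Types (M N X Y : {set V}) (u v w x y z : V).

Local Notation is_module := (is_module arc).
Local Notation nontrivial := (nontrivial_module arc).
Local Notation comodule := (comodule arc).
Local Notation mc := (minimal_comodules arc).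

Lemma arc_irr x : arc x x = false.
Proof. by case: tournT => irr _; apply: irr. Qed.

Lemma arc_neq x y : arc x y -> x != y.
Proof. by apply: contraTneq => ->; rewrite arc_irr. Qed.

Lemma arcC x y : x != y -> arc y x = ~~ arc x y.
Proof. by case: tournT => _ tot /tot; case: (arc x y); case: (arc y x). Qed.

Lemma arc_asym x y : arc x y -> arc y x = false.
Proof. by move=> xy; rewrite arcC ?xy // arc_neq. Qed.

Lemma moduleP M :
  reflect (forall x y v, x \in M -> y \in M -> v \notin M -> arc v x = arc v y)
          (is_module M).
Proof.
apply: (iffP idP) => [/forall_inP modM x y v Mx My Mv|modM].
  by apply/eqP; apply: (forall_inP (forall_inP (modM x Mx) y My)); rewrite inE.
apply/forall_inP => x Mx; apply/forall_inP => y My; apply/forall_inP => v.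
by rewrite inE => Mv; apply/eqP; apply: modM.
Qed.

Lemma module_out M x y v :
  is_module M -> x \in M -> y \in M -> v \notin M -> arc x v = arc y v.
Proof.
move=> /moduleP modM Mx My Mv.
have neqv z : z \in M -> v != z by apply: contraTneq => <-.
by rewrite (arcC (neqv x Mx)) (arcC (neqv y My)) (modM x y).
Qed.

Lemma moduleI M N : is_module M -> is_module N -> is_module (M :&: N).
Proof.
move=> /moduleP modM /moduleP modN; apply/moduleP => x y v.
move=> /setIP[Mx Nx] /setIP[My Ny]; rewrite inE negb_and => /orP[] nv.
  exact: modM.
exact: modN.
Qed.

Lemma moduleU M N :
  is_module M -> is_module N -> M :&: N != set0 -> is_module (M :|: N).
Proof.
move=> /moduleP modM /moduleP modN /set0Pn[u /setIP[Mu Nu]].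
apply/moduleP => x y v xMN yMN; rewrite inE negb_or => /andP[Mv Nv].
suff to_u z : z \in M :|: N -> arc v z = arc v u by rewrite !to_u.
by case/setUP=> [Mz|Nz]; [apply: modM | apply: modN].
Qed.

Lemma moduleD M N :
  is_module M -> is_module N -> N :\: M != set0 -> is_module (M :\: N).
Proof.
move=> modM modN /set0Pn[u /setDP[Nu Mu]]; apply/moduleP => x y v.
move=> /setDP[Mx Nx] /setDP[My Ny]; rewrite inE negb_and negbK.
(* For [v] in [N], the vertex [u] of [N] outside [M] has the same arcs as [v] to [x] and [y]. *)
case/orP=> [Nv|Mv]; last by move/moduleP: modM; apply.
rewrite (module_out modN Nv Nu Nx) (module_out modN Nv Nu Ny).
by move/moduleP: modM; apply.
Qed.

Lemma nontrivialE M :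
  nontrivial M = [&& is_module M, 1 < #|M| & M != setT].
Proof.
rewrite /nontrivial_module /trivial_module orbA negb_or; congr [&& _, _ & _].
rewrite ltnNge leq_eqVlt ltnS leqn0 cards_eq0 orbC; congr (~~ (_ || _)).
by apply/existsP/cards1P => [[u /eqP->]|[u ->]]; exists u.
Qed.

Lemma comoduleC M : comodule (~: M) = comodule M.
Proof. by rewrite /Defs.comodule setCK orbC. Qed.

Lemma comodule_neq0 M : comodule M -> M != set0.
Proof.
apply: contraTneq => ->; rewrite /Defs.comodule !nontrivialE cards0 /= setC0.
by rewrite eqxx !andbF.
Qed.

(** * Minimal co-modules and their intersections *)

Lemma mc_min X Y : X \in mc -> comodule Y -> Y \subset X -> Y = X.
Proof. by rewrite inE => /minsetP[_ minX]; apply: minX. Qed.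

Lemma mc_comodule X : X \in mc -> comodule X.
Proof. by rewrite inE => /minsetP[]. Qed.

Lemma comodule_mc M : comodule M -> exists2 X, X \in mc & X \subset M.
Proof.
move=> /minset_exists[X minX sXM]; by exists X; rewrite ?inE.
Qed.

Lemma mc_proper_module X Y :
  X \in mc -> is_module Y -> Y \proper X -> #|Y| <= 1.
Proof.
move=> mcX modY ltYX; rewrite leqNgt; apply/negP => Y2.
have ntY : nontrivial Y.
  rewrite nontrivialE modY Y2 /=; apply: contraTneq ltYX => ->.
  by rewrite /proper subsetT andbF.
have := mc_min mcX _ (proper_sub ltYX); rewrite /Defs.comodule ntY => /(_ isT).
by move=> eYX; rewrite eYX properxx in ltYX.
Qed.

Lemma mc_proper_comodule X Y : X \in mc -> Y \proper X -> ~~ comodule Y.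
Proof.
move=> mcX ltYX; apply/negP => coY.
by have := ltYX; rewrite (mc_min mcX coY (proper_sub ltYX)) properxx.
Qed.

Lemma mc_meet_proper X Y :
  X \in mc -> Y \in mc -> X != Y -> X :&: Y \proper X /\ X :\: Y != set0.
Proof.
move=> mcX mcY neqXY.
have nsXY : ~~ (X \subset Y).
  apply: contraNN neqXY => sXY.
  by rewrite (mc_min mcY (mc_comodule mcX) sXY).
split; last by rewrite setD_eq0.
by rewrite properE subsetIl subsetI subxx.
Qed.

(** If they met, the union of the overlapping modules [X] and [~: Y] would be a module, and its
    complement [Y :\: X] a co-module strictly smaller than [Y]. *)
Lemma mc_module_comodule_disjoint X Y :
  X \in mc -> Y \in mc -> X != Y -> nontrivial X -> nontrivial (~: Y) ->
  X :&: Y = set0.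
Proof.
move=> mcX mcY neqXY; rewrite !nontrivialE.
move=> /and3P[modX X2 XT] /and3P[modY Y2 YT]; apply/eqP/negPn/negP => XY0.
have [_ XDY] := mc_meet_proper mcX mcY neqXY.
have [ltYX YDX] := mc_meet_proper mcY mcX (contra_neq (@esym _ _ _) neqXY).
have: ~~ comodule (Y :\: X).
  apply: mc_proper_comodule mcY _; rewrite properEneq subsetDl andbT.
  by apply: contraNneq XY0 => eY; rewrite -eY setIDA setDIl setDv set0I.
case/negP; rewrite -comoduleC /Defs.comodule nontrivialE setCD.
rewrite moduleU //=; last by rewrite setIC -setDE.
rewrite (leq_trans Y2) ?subset_leq_card ?subsetUl //=.
by rewrite -setCD -setC0 (inj_eq (@setC_inj V)) YDX.
Qed.

Lemma mc_meet_pair X Y :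
  X \in mc -> Y \in mc -> X != Y -> X :&: Y != set0 ->
  is_module X && (#|X| == 2).
Proof.
move=> mcX mcY neqXY XY0; have neqYX := contra_neq (@esym _ _ _) neqXY.
have [ltXY XDY] := mc_meet_proper mcX mcY neqXY.
have [ltYX YDX] := mc_meet_proper mcY mcX neqYX.
case/orP: (mc_comodule mcX) (mc_comodule mcY) => ntX /orP[] ntY.
(* Two modules: [X :&: Y] and [X :\: Y] are modules properly inside [X], so each has at most one
   element. *)
- move: ntX ntY; rewrite !nontrivialE => /and3P[modX X2 _] /and3P[modY _ _].
  rewrite modX eqn_leq X2 andbT -(cardsID Y X) (leq_add (n1 := 1) (n2 := 1)) //.
    by apply: mc_proper_module ltXY; rewrite // moduleI.
  apply: mc_proper_module (mcX) _ _; first exact: moduleD.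
  rewrite properEneq subsetDl andbT; apply: contraNneq XY0 => <-.
  by rewrite setIC setIDA setDIl setDv set0I.
- by rewrite mc_module_comodule_disjoint ?eqxx in XY0.
- by rewrite setIC mc_module_comodule_disjoint ?eqxx in XY0.
(* Both complements are modules. If they are disjoint, minimality gives [Y = ~: X]; otherwise their
   union is a module and [X :&: Y] a smaller co-module. *)
have [XYT|XYC] := eqVneq (~: X :&: ~: Y) set0.
  have sCXY : ~: X \subset Y by rewrite -setD_eq0 setDE XYT.
  have eY : ~: X = Y.
    by apply: mc_min mcY _ sCXY; rewrite comoduleC mc_comodule.
  by rewrite -eY setICr eqxx in XY0.
case/negP: (mc_proper_comodule mcX ltXY); rewrite -comoduleC setCI.
move: ntX ntY; rewrite /Defs.comodule !nontrivialE.
move=> /and3P[modX X2 _] /and3P[modY _ _].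
rewrite moduleU //= (leq_trans X2) ?subset_leq_card ?subsetUl //=.
by rewrite -setCI -setC0 (inj_eq (@setC_inj V)) XY0.
Qed.

(** Two such vertices would be a source and a sink, which every vertex outside [M] tells apart. *)
Lemma module_co_singletons M u v :
  nontrivial M -> u \in M -> v \in M -> comodule [set u] -> comodule [set v] ->
  u = v.
Proof.
have co1 x : comodule [set x] -> is_module (~: [set x]).
  by rewrite /Defs.comodule !nontrivialE cards1 andbF => /andP[].
rewrite nontrivialE => /and3P[modM _ MT] Mu Mv /co1/moduleP mu /co1/moduleP mv.
apply/eqP/negPn/negP => neq_uv.
have /subsetPn[z _ Mz] : ~~ (setT \subset M) by rewrite subTset.
have neqz x : x \in M -> z != x by apply: contraTneq => <-.
have e1 : arc u v = arc u z.
  by apply: mu; rewrite !inE ?eqxx ?neqz // eq_sym.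
have e2 : arc v u = arc v z by apply: mv; rewrite !inE ?eqxx ?neqz.
by move: (arcC neq_uv); rewrite e1 e2 (module_out modM Mu Mv Mz); case: (arc v z).
Qed.


(* The module condition matters: when T - {x, y} is a module M and
   x -> M -> y -> x, the pair {x, y} can be a minimal co-module without being a
   module. *)
Definition twin X := is_module X && (#|X| == 2).

Lemma mc_meet X Y z :
  X \in mc -> Y \in mc -> z \in X -> z \in Y -> ~~ twin X -> X = Y.
Proof.
move=> mcX mcY Xz Yz; apply: contraNeq => neqXY.
by apply: mc_meet_pair neqXY _ => //; apply/set0Pn; exists z; apply/setIP.
Qed.

(** * Chains of two-element modules *)

Definition succ x y := [&& arc x y, [set x; y] \in mc & is_module [set x; y]].

Lemma succ_arc x y : succ x y -> arc x y.
Proof. by case/and3P. Qed.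

Lemma twin_succ X :
  X \in mc -> twin X -> exists x y, X = [set x; y] /\ succ x y.
Proof.
move=> mcX /andP[modX /cards2P[x [y [neq_xy eX]]]]; subst X.
case xy: (arc x y); first by exists x, y; rewrite /succ xy mcX.
exists y, x; split; first exact: setUC.
by rewrite /succ setUC mcX modX (arcC neq_xy) xy.
Qed.

Lemma succ_twin x y : succ x y -> twin [set x; y].
Proof. by case/and3P=> xy _ modxy; rewrite /twin modxy cards2 arc_neq. Qed.

Lemma succ_to x y z : succ x y -> z != x -> z != y -> arc z x = arc z y.
Proof.
case/and3P=> _ _ /moduleP modxy zx zy.
by apply: modxy; rewrite !inE ?eqxx ?orbT // negb_or zx.
Qed.

Lemma succ_from x y z : succ x y -> z != x -> z != y -> arc x z = arc y z.
Proof.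
by move=> xy zx zy; rewrite (arcC zx) (arcC zy) (succ_to xy).
Qed.

(** Of two distinct predecessors, each would dominate the other. *)
Lemma succ_inj x x' y : succ x y -> succ x' y -> x = x'.
Proof.
move=> xy x'y; apply/eqP/negPn/negP => neq.
have neqx := arc_neq (succ_arc xy); have neqx' := arc_neq (succ_arc x'y).
have := arcC neq; rewrite (succ_to x'y) // (succ_to xy) //; last by rewrite eq_sym.
by rewrite !succ_arc.
Qed.

Lemma succ_fun x y y' : succ x y -> succ x y' -> y = y'.
Proof.
move=> xy xy'; apply/eqP/negPn/negP => neq.
have neqy := arc_neq (succ_arc xy); have neqy' := arc_neq (succ_arc xy').
have := arcC neq; rewrite -(succ_from xy) 1?eq_sym //.
by rewrite -(succ_from xy') 1?eq_sym ?succ_arc // eq_sym.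
Qed.

Lemma succ_not_comodule x y z :
  succ x y -> z \in [set x; y] -> ~~ comodule [set z].
Proof.
move=> xy xyz; have /andP[_ /eqP c2] := succ_twin xy.
have /and3P[_ mcxy _] := xy.
apply: mc_proper_comodule mcxy _.
by rewrite properEcard sub1set xyz cards1 c2.
Qed.

Definition outdeg x := #|[set z | arc x z]|.

Lemma outdeg_succ x y : succ x y -> outdeg x = (outdeg y).+1.
Proof.
move=> xy; rewrite /outdeg.
have -> : [set z | arc x z] = y |: [set z | arc y z].
  apply/setP => z; rewrite !inE.
  have [->|zy] := eqVneq z y; first exact: succ_arc.
  have [->|zx] := eqVneq z x; last exact: succ_from.
  by rewrite arc_irr (arc_asym (succ_arc xy)).
by rewrite cardsU1 inE arc_irr.
Qed.

Local Notation chain := (connect succ).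

Lemma chain_first x y : chain x y -> x = y \/ exists2 z, succ x z & chain z y.
Proof.
case/connectP=> [[|z p] /= pth ->]; first by left.
by right; case/andP: pth => xz zp; exists z => //; apply/connectP; exists p.
Qed.

Lemma chain_last x y : chain x y -> x = y \/ exists2 z, chain x z & succ z y.
Proof.
case/connectP=> p; case/lastP: p => [|p z] pth ->; first by left.
right; move: pth; rewrite rcons_path last_rcons => /andP[xp pz].
by exists (last x p) => //; apply/connectP; exists p.
Qed.

Lemma chain_ind (P : V -> Prop) x y :
    chain x y -> (forall z t, chain x z -> succ z t -> P z -> P t) ->
  P x -> P y.
Proof.
case/connectP=> p pth ->; elim/last_ind: p pth => // p z IHp.
rewrite rcons_path last_rcons => /andP[xp pz] step Px.
apply: (step _ _ _ pz); last exact: IHp.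
by apply/connectP; exists p.
Qed.

(** Each link of the chain is a module avoiding [a], so the arc from [a] passes from one end of the
    link to the other. *)
Lemma chain_to a x y : chain x y -> arc a x -> arc a y.
Proof.
move=> xy; apply: (chain_ind (P := arc a) xy) => /= z t _ zt az.
rewrite -(succ_to zt) //; first exact: arc_neq.
by apply: contraTneq az => ->; rewrite arc_asym // succ_arc.
Qed.

Lemma chain_arc x y : chain x y -> x != y -> arc x y.
Proof.
case/chain_first=> [->|[z xz zy] _]; first by rewrite eqxx.
exact: chain_to zy (succ_arc xz).
Qed.

(** As predecessors are unique, this is the position of [x] from the top of its chain, starting at
    1. *)
Definition depth x := #|[set z | chain z x]|.

Lemma depth_succ x y : succ x y -> depth y = (depth x).+1.
Proof.
move=> xy; rewrite /depth.
have -> : [set z | chain z y] = y |: [set z | chain z x].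
  apply/setP => z; rewrite !inE; apply/idP/predU1P => [|[->|zx]].
  - case/chain_last=> [->|[t zt ty]]; first by left.
    by right; rewrite (succ_inj xy ty).
  - exact: connect0.
  - exact: connect_trans zx (connect1 xy).
rewrite cardsU1 inE (negPf (_ : ~~ chain y x)) //; apply/negP => yx.
have nyx : y != x by rewrite eq_sym arc_neq // succ_arc.
by have := chain_arc yx nyx; rewrite arc_asym // succ_arc.
Qed.

Lemma depth_nosucc y : (forall x, ~~ succ x y) -> depth y = 1.
Proof.
move=> nosucc; rewrite /depth -(cards1 y); apply: eq_card => z; rewrite !inE.
apply/idP/eqP => [|->]; last exact: connect0.
by case/chain_last=> // -[t _ ty]; rewrite (negPf (nosucc t)) in ty.
Qed.

(** * Sources, sinks and the second sink *)

(** A singleton is a trivial module, so its complement is the nontrivial one; hence [v] is a source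
    or a sink. *)
Lemma comodule1_module v : comodule [set v] -> is_module (~: [set v]).
Proof. by rewrite /Defs.comodule !nontrivialE cards1 andbF => /andP[]. Qed.

Lemma comodule1_arc v x y :
  comodule [set v] -> x != v -> y != v -> arc v x = arc v y.
Proof.
move=> /comodule1_module/moduleP modv xv yv.
by apply: modv; rewrite !inE ?xv ?yv // negbK.
Qed.

Lemma comodule1_pair_arc v w z :
    nontrivial [set v; w] -> comodule [set v] -> w != v -> z \notin [set v; w] ->
  arc v z = arc v w /\ arc w z = arc v w.
Proof.
rewrite nontrivialE => /and3P[modvw _ _] cov wv zvw.
have -> : arc w z = arc v z.
  by apply: module_out modvw _ _ zvw; rewrite !inE eqxx ?orbT.
split=> //; first apply: comodule1_arc => //.
  by apply: contraNneq zvw => ->; rewrite !inE eqxx.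
by apply: comodule1_arc => //; apply: contraNneq zvw => ->; rewrite !inE eqxx.
Qed.

(** Here [v] is the sink, and [w] is dominated by all remaining vertices; nontriviality of the pair
    forces order at least three. *)
Definition second_sink w :=
  [exists v, [&& nontrivial [set v; w], comodule [set v] & arc w v]].

Lemma second_sink_out w z :
  second_sink w -> arc w z -> comodule [set z] /\ outdeg w = 1.
Proof.
case/existsP=> v /and3P[ntvw cov wv] wz.
have out y : arc w y -> y = v.
  move=> wy; apply/eqP/negPn/negP => yv.
  have yvw : y \notin [set v; w].
    by rewrite !inE negb_or yv eq_sym arc_neq.
  have [_] := comodule1_pair_arc ntvw cov (arc_neq wv) yvw.
  by rewrite wy (arc_asym wv).
split; first by rewrite (out z wz).
rewrite /outdeg -(cards1 v); apply: eq_card => y; rewrite !inE.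
by apply/idP/eqP => [/out|->].
Qed.

(** The only candidate is the sink, whose singleton is a co-module and so lies in no link. *)
Lemma second_sink_nosucc w y : second_sink w -> ~~ succ w y.
Proof.
move=> sw; apply/negP => wy; have [coy _] := second_sink_out sw (succ_arc wy).
by move: coy; apply/negP; apply: succ_not_comodule wy _; rewrite !inE eqxx orbT.
Qed.

Lemma outdeg_second_sink w : second_sink w -> outdeg w = 1.
Proof.
by move=> sw; case/existsP: (sw) => v /and3P[_ _] /(second_sink_out sw)[].
Qed.

(** * Alternate vertices of the chains *)

Definition low x := [exists w, second_sink w && chain x w].

Lemma low_succ x y : succ x y -> low x = low y.
Proof.
move=> xy; apply/existsP/existsP => -[w /andP[sw]].
  case/chain_first=> [xw|[t xt tw]].
    by move: xy; rewrite xw (negPf (second_sink_nosucc y sw)).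
  by exists w; rewrite sw (succ_fun xy xt).
by move=> yw; exists w; rewrite sw (connect_trans (connect1 xy)).
Qed.

(* Positions are counted from the bottom of the chain when it ends in the second
   sink, where the position of x is its out-degree, and from the top otherwise. *)
Definition chosen x := ~~ odd (if low x then outdeg x else depth x).

Lemma chosen_succ x y : succ x y -> chosen x = ~~ chosen y.
Proof.
move=> xy; rewrite /chosen (low_succ xy); case: (low y).
  by rewrite (outdeg_succ xy).
by rewrite (depth_succ xy) /= negbK.
Qed.

(** The partner of [x] lies towards the end from which positions are counted; this common direction
    keeps the matching disjoint. *)
Definition oriented x X :=
  forall z, z \in X -> z != x -> if low x then succ x z else succ z x.

(** The end from which positions are counted has the odd position 1, so a chosen vertex has a
    neighbour on that side. *)
Lemma chosen_edge x :
  chosen x -> exists X, [/\ X \in mc, x \in X, twin X & oriented x X].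
Proof.
rewrite /chosen; case lx: (low x) => [] cx.
  case/existsP: lx (lx) => w /andP[sw /chain_first[xw|[y xy yw]]] lx.
    by rewrite xw outdeg_second_sink in cx.
  have /and3P[_ mcxy _] := xy; exists [set x; y]; rewrite mcxy succ_twin //.
  split=> // [|z]; first by rewrite !inE eqxx.
  by rewrite !inE lx => /orP[]/eqP->; rewrite ?eqxx.
have [/existsP[y yx]|] := boolP [exists y, succ y x]; last first.
  by rewrite negb_exists => /forallP/depth_nosucc ex; rewrite ex in cx.
have /and3P[_ mcyx _] := yx; exists [set y; x]; rewrite mcyx succ_twin //.
split=> // [|z]; first by rewrite !inE eqxx orbT.
by rewrite !inE lx => /orP[]/eqP->; rewrite ?eqxx.
Qed.

(** * The exact transversal and its matching *)

(** By [chosen_edge], chosen vertices lie in twins; every other member of [mc] is disjoint from the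
    rest and contributes one arbitrary vertex. *)
Definition rep_set :=
  [set x | chosen x ||
    [exists X in mc, ~~ twin X && ([pick y in X] == Some x)]].

Lemma rep_set_edge x :
    x \in rep_set ->
  exists X, [/\ X \in mc, x \in X & twin X -> oriented x X].
Proof.
rewrite inE => /orP[/chosen_edge[X [? ? _ ?]]|]; first by exists X.
case/existsP=> X /and3P[mcX ntX]; case: pickP => // y Xy /eqP[<-].
by exists X; split=> //; rewrite (negPf ntX).
Qed.

Lemma rep_set_twin X x :
  X \in mc -> x \in X -> twin X -> (x \in rep_set) = chosen x.
Proof.
move=> mcX Xx twX; rewrite inE orb_idr // => /existsP[Y /and3P[mcY ntY]].
case: pickP => // y Yy /eqP[eyx]; rewrite eyx in Yy.
by case/negP: (ntY); rewrite (mc_meet mcY mcX Yy Xx ntY).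
Qed.

Lemma rep_set_ntwin X x :
    X \in mc -> x \in X -> ~~ twin X ->
  (x \in rep_set) = ([pick y in X] == Some x).
Proof.
move=> mcX Xx ntX; rewrite inE; apply/orP/eqP => [[]|pickX].
- case/chosen_edge=> Y [mcY Yx twY _].
  by move: twY; rewrite -(mc_meet mcX mcY Xx Yx ntX) (negPf ntX).
- case/existsP=> Y /and3P[mcY ntY /eqP pickY]; suff <- : Y = X by [].
  move: pickY; case: pickP => // y Yy [eyx]; rewrite eyx in Yy.
  exact: mc_meet Yy Xx _.
by right; apply/existsP; exists X; rewrite mcX ntX pickX eqxx.
Qed.

Lemma rep_set_uniq X x y :
  X \in mc -> x \in X -> y \in X -> x \in rep_set -> y \in rep_set -> x = y.
Proof.
move=> mcX Xx Xy; have [twX|ntX] := boolP (twin X).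
  rewrite !(rep_set_twin mcX) //.
  have [a [b [eX ab]]] := twin_succ mcX twX.
  move: Xx Xy; rewrite eX !inE => /orP[]/eqP-> /orP[]/eqP->;
    by rewrite ?(chosen_succ ab); case: chosen.
by rewrite !(rep_set_ntwin mcX) // => /eqP-> /eqP[].
Qed.

Lemma rep_set_ex X : X \in mc -> exists2 x, x \in X & x \in rep_set.
Proof.
move=> mcX; have [twX|ntX] := boolP (twin X).
  have [a [b [eX ab]]] := twin_succ mcX twX.
  have [Xa Xb] : a \in X /\ b \in X by rewrite eX !inE !eqxx orbT.
  case cb: (chosen b); first by exists b; rewrite // (rep_set_twin mcX).
  by exists a; rewrite // (rep_set_twin mcX) // (chosen_succ ab) cb.
have /set0Pn[x0 Xx0] := comodule_neq0 (mc_comodule mcX).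
case pickX: [pick y in X] => [x|]; last first.
  by move: pickX; case: pickP => // no; rewrite no in Xx0.
have Xx : x \in X by move: pickX; case: pickP => // y Xy [<-].
by exists x; rewrite // (rep_set_ntwin mcX) // pickX.
Qed.

Lemma rep_set_transversal : transversal mc rep_set.
Proof. by apply/transversalP => X /rep_set_ex. Qed.

Lemma rep_set_exact : exact_transversal mc rep_set.
Proof.
apply/andP; split; first exact: rep_set_transversal.
apply/forall_inP => X mcX; have [x Xx Rx] := rep_set_ex mcX.
apply/cards1P; exists x; apply/setP => y; rewrite in_setI in_set1.
apply/andP/eqP => [[Xy Ry]|->]; last by split.
exact: rep_set_uniq mcX Xy Xx Ry Rx.
Qed.

Lemma rep_set_matching : exists2 P, matching mc P & #|rep_set| <= #|P|.
Proof.
have /fin_all_exists[f fP] x : exists X, x \in rep_set ->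
    [/\ X \in mc, x \in X & twin X -> oriented x X].
  have [/rep_set_edge[X HX]|_] := boolP (x \in rep_set); first by exists X.
  by exists set0.
have f_inj : {in rep_set &, injective f}.
  move=> x y Rx Ry efxy; have [mcfx fx _] := fP x Rx; have [_ fy _] := fP y Ry.
  by apply: rep_set_uniq mcfx _ _ Rx Ry; rewrite // efxy.
exists (f @: rep_set); last by rewrite card_in_imset.
apply/andP; split; first by apply/subsetP => _ /imsetP[x /fP[? _ _] ->].
apply/trivIsetP => _ _ /imsetP[x Rx ->] /imsetP[y Ry ->] neqf.
rewrite -setI_eq0; apply: contraNT neqf => /set0Pn[z /setIP[fxz fyz]].
have [mcfx fxx orx] := fP x Rx; have [mcfy fyy ory] := fP y Ry.
have [twx|] := boolP (twin (f x)); last by move/(mc_meet mcfx mcfy fxz fyz)->.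
have [twy|] := boolP (twin (f y)); last by move/(mc_meet mcfy mcfx fyz fxz)->.
have [zx|zx] := eqVneq z x.
  by rewrite (rep_set_uniq mcfy _ fyy Rx Ry) // -zx.
have [zy|zy] := eqVneq z y.
  by rewrite (rep_set_uniq mcfx fxx _ Rx Ry) // -zy.
have := orx twx z fxz zx; have := ory twy z fyz zy.
case ly: (low y) => yz; case lx: (low x) => xz.
- by rewrite (succ_inj xz yz).
- by rewrite (low_succ yz) (low_succ xz) lx in ly.
- by rewrite (low_succ xz) (low_succ yz) ly in lx.
- by rewrite (succ_fun xz yz).
Qed.


(** * Strict bipartiteness *)

(** The source, the chain from the second source to the second sink, and the sink exhaust the
    tournament in this order. *)
Lemma source_chain_transitive v w :
    nontrivial [set v; w] -> comodule [set v] -> arc v w -> low w ->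
  transitive arc /\ odd (outdeg w) = odd #|V|.
Proof.
move=> ntvw cov vw /existsP[s /andP[ss ws]].
have wv : w != v by rewrite eq_sym arc_neq.
have out_v z : z != v -> arc v z by move=> zv; rewrite (comodule1_arc cov zv wv).
have out_w z : z \notin [set v; w] -> arc w z.
  by move=> zvw; have [_ ->] := comodule1_pair_arc ntvw cov wv zvw.
(* Invariant along the chain: [x] dominates every vertex except [v] and those from [w] to [x]. *)
pose above x := forall z, [\/ z = v, chain w z /\ chain z x | arc x z].
have aboveP x : chain w x -> above x.
  move=> wx; apply: (chain_ind (P := above) wx) => /= [y t wy yt IHy z|z].
    have wt := connect_trans wy (connect1 yt).
    case: (IHy z) => [|[wz zy]|yz]; first by constructor 1.
      by constructor 2; split; rewrite ?(connect_trans zy (connect1 yt)).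
    have [->|zt] := eqVneq z t; first by constructor 2.
    by constructor 3; rewrite -(succ_from yt) // eq_sym arc_neq.
  have [/set2P[]->|/out_w] := boolP (z \in [set v; w]);
    by [constructor 1 | constructor 2 | constructor 3].
split=> [b a c ab bc|].
  (* The vertex [c] is the source, lies on the chain, or is the sink. On the chain, [b] precedes
     [c], and [chain_to] carries the arc from [a] down to [c]. *)
  case: (aboveP s ws c) => [cv|[wc cs]|sc].
  - have bv : b != v by rewrite -cv arc_neq.
    by rewrite cv (arc_asym (out_v b bv)) in bc.
  - case: (aboveP c wc b) => [bv|[_ bc']|cb]; last 1 first.
    + by rewrite (arc_asym bc) in cb.
    + have av : a != v by rewrite -bv arc_neq.
      by rewrite bv (arc_asym (out_v a av)) in ab.
    + exact: chain_to bc' ab.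
  have [coc _] := second_sink_out ss sc.
  have ac : c != a by apply: contraTneq ab => <-; rewrite arc_asym.
  rewrite (arcC ac) (comodule1_arc coc _ (arc_neq bc)) 1?eq_sym //.
  by rewrite (arc_asym bc).
(* The out-neighbours of [w] are exactly the vertices outside the pair, so the parities agree. *)
rewrite -(cardsC [set v; w]) cards2 eq_sym wv /= negbK; congr (odd _).
apply: eq_card => z; rewrite !inE; have [|zvw] := boolP (z \in [set v; w]).
  by case/set2P=> ->; rewrite ?arc_irr ?(arc_asym vw) ?eqxx ?orbT.
by rewrite out_w //; rewrite !inE in zvw; rewrite zvw.
Qed.

(** Keeps [w] from being the arbitrary pick of a non-twin. Minimality gives [v \notin X]; then
    removing [w] leaves a module of at most one vertex, or forces [X = [set w]], a second co-module
    singleton in the pair. *)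
Lemma mc_twin_of_comodule1_pair v w X :
    nontrivial [set v; w] -> comodule [set v] -> w != v ->
  X \in mc -> w \in X -> twin X.
Proof.
move=> ntvw cov wv mcX Xw.
have Xv : v \notin X.
  apply: contraNN wv => Xv; rewrite -in_set1 (mc_min mcX cov) //.
  by rewrite sub1set.
have [modvw _ _] := and3P (etrans (esym (nontrivialE _)) ntvw).
have ltXD : X :\: [set v; w] \proper X.
  rewrite properEneq subsetDl andbT; apply: contraTneq Xw => <-.
  by rewrite !inE eqxx orbT.
case/orP: (mc_comodule mcX) => ntX.
  have [modX X2 _] := and3P (etrans (esym (nontrivialE _)) ntX).
  rewrite /twin modX eqn_leq X2 andbT -(cardsID [set v; w] X).
  apply: (leq_add (n1 := 1) (n2 := 1)).
    rewrite -(cards1 w) subset_leq_card //; apply/subsetP => z.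
    by rewrite !inE => /andP[Xz /orP[/eqP zv|//]]; rewrite -zv Xz in Xv.
  apply: mc_proper_module mcX _ ltXD; apply: moduleD => //.
  by apply/set0Pn; exists v; rewrite !inE eqxx Xv.
have [modX X2 _] := and3P (etrans (esym (nontrivialE _)) ntX).
have: ~~ comodule (X :\: [set v; w]) by apply: mc_proper_comodule mcX ltXD.
rewrite -comoduleC /Defs.comodule nontrivialE setCD negb_or moduleU //=; last first.
  by apply/set0Pn; exists v; rewrite !inE eqxx Xv.
rewrite (leq_trans X2) ?subset_leq_card ?subsetUl //= negbK => /andP[/eqP XT _].
have eX : X = [set w].
  apply/setP => z; rewrite inE; apply/idP/eqP => [Xz|->//].
  have : z \in ~: X :|: [set v; w] by rewrite XT.
  by rewrite !inE Xz /= => /orP[]/eqP // zv; rewrite -zv Xz in Xv.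
have cow := mc_comodule mcX; rewrite eX in cow.
have := module_co_singletons ntvw _ _ cov cow; rewrite !inE !eqxx orbT.
by move=> /(_ isT isT) evw; rewrite evw eqxx in wv.
Qed.

Lemma rep_set_not_sub M :
    ~ (transitive arc /\ ~~ odd #|V|) -> nontrivial M ->
  ~~ (M \subset rep_set).
Proof.
move=> not_even_trans ntM; apply/negP => sMR.
have [modM M2 MT] := and3P (etrans (esym (nontrivialE _)) ntM).
(* By exactness, a minimal co-module contained in [rep_set] is a singleton. *)
have sub1 N : nontrivial N -> N \subset M -> exists2 v, v \in N & comodule [set v].
  move=> ntN sNM; have coN : comodule N by rewrite /Defs.comodule ntN.
  have [X mcX sXN] := comodule_mc coN; have [v Xv Rv] := rep_set_ex mcX.
  exists v; first exact: (subsetP sXN).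
  suff <- : X = [set v] by apply: mc_comodule.
  apply/setP => z; rewrite inE; apply/idP/eqP => [Xz|->//].
  have Rz := subsetP (subset_trans sXN (subset_trans sNM sMR)) z Xz.
  exact: rep_set_uniq mcX Xz Xv Rz Rv.
have [v Mv cov] := sub1 M ntM (subxx M).
(* Were [M :\ v] larger, it would be a nontrivial module containing another co-module singleton. *)
have [w eMv] : exists w, M :\ v = [set w].
  apply/cards1P; rewrite eqn_leq andbC.
  rewrite (cardsD1 v) Mv ltnS in M2; rewrite M2 leqNgt; apply/negP => Mv2.
  have ntMv : nontrivial (M :\ v).
    rewrite nontrivialE Mv2 setDE moduleI ?comodule1_module //=.
    by apply/eqP => /setP/(_ v); rewrite !inE eqxx andbF.
  have [u] := sub1 _ ntMv (subsetDl _ _); rewrite !inE => /andP[uv Mu] cou.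
  by rewrite (module_co_singletons ntM Mu Mv cou cov) eqxx in uv.
have [wv Mw] : w != v /\ w \in M.
  by apply/andP; rewrite -in_setD1 eMv inE.
have eM : M = [set v; w] by rewrite -(setD1K Mv) eMv.
rewrite eM in ntM; have := subsetP sMR w Mw; rewrite inE => /orP[cw|]; last first.
  case/existsP=> X /and3P[mcX ntX]; case: pickP => // y Xy /eqP[eyw].
  case/negP: (ntX); apply: mc_twin_of_comodule1_pair ntM cov wv mcX _.
  by rewrite -eyw.
(* If [v] is the sink, [w] has odd position 1. If [v] is the source, either the chain of [w] is
   [low] and the excluded case arises, or [w] has a predecessor, which only [v] could be; but [v] is
   on no link. *)
case vw: (arc v w); last first.
  have sw : second_sink w.
    by apply/existsP; exists v; rewrite ntM cov (arcC (_ : v != w)) ?vw // eq_sym.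
  have lw : low w by apply/existsP; exists w; rewrite sw connect0.
  by rewrite /chosen lw outdeg_second_sink in cw.
have [X [mcX Xw twX orX]] := chosen_edge cw.
case lw: (low w).
  have [trT eodd] := source_chain_transitive ntM cov vw lw.
  by apply: not_even_trans; split; rewrite // -eodd; rewrite /chosen lw in cw.
have [z Xz zw] : exists2 z, z \in X & z != w.
  have /andP[_ /eqP c2] := twX.
  have : 0 < #|X :\ w| by rewrite (cardsD1 w) Xw in c2; case: c2; case: #|_|.
  by case/card_gt0P=> z; rewrite !inE => /andP[zw Xz]; exists z.
have := orX z Xz zw; rewrite lw => szw.
have [zv|zv] := eqVneq z v.
  have := succ_not_comodule szw (_ : z \in _); rewrite !inE eqxx => /(_ isT).
  by rewrite zv cov.
have zvw : z \notin [set v; w] by rewrite !inE negb_or zv.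
have [_] := comodule1_pair_arc ntM cov wv zvw.
by rewrite vw arc_asym // succ_arc.
Qed.

Lemma rep_set_strictly_bipartite :
    ~ (transitive arc /\ ~~ odd #|V|) ->
  strictly_bipartite_by (nontrivial_modules arc) rep_set.
Proof.
move=> not_even_trans; apply/forall_inP => M; rewrite inE => ntM.
have hit N : comodule N -> exists2 x, x \in N & x \in rep_set.
  case/comodule_mc=> X mcX sXN; have [x Xx Rx] := rep_set_ex mcX.
  by exists x; first exact: (subsetP sXN).
have coM : comodule M by rewrite /Defs.comodule ntM.
apply/and3P; split.
- by have [x Mx Rx] := hit M coM; apply/set0Pn; exists x; apply/setIP.
- have [|x] := hit (~: M); first by rewrite comoduleC.
  by rewrite inE => Mx Rx; apply/set0Pn; exists x; apply/setDP.
- by rewrite setD_eq0 rep_set_not_sub.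
Qed.

End Modules.

Theorem theorem3p2 (V : finType) (arc : rel V)
    (tournT : tournament arc)
    (not_even_transitive : ~ (transitive arc /\ ~~ odd #|V|)) :
  (exists R : {set V},
     [/\ exact_transversal (minimal_comodules arc) R,
         minimum_transversal (minimal_comodules arc) R
       & strictly_bipartite_by (nontrivial_modules arc) R]) /\
  matching_number (minimal_comodules arc) =
  transversal_number (minimal_comodules arc).
Proof.
have [P mP leRP] := rep_set_matching tournT.
have [minR konig] :=
  matching_transversal_konig mP (rep_set_transversal tournT) leRP.
split=> //; exists (rep_set arc); split=> //; first exact: rep_set_exact.
exact: rep_set_strictly_bipartite.
Qed.
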